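(* Let $\bar P$ be a Markov kernel on a finite set $\bar V$, let $\bar G$ be a subgroup of $\mathcal{S}_{\bar P}$, let $V$ be the set of equivalence classes (orbits) of $\bar V$ under $\bar G$, let $\pi:\bar V\to V$ be the projection, and let $P$ be the Markov kernel on $V$ defined by $P(x,y)=\sum_{\bar y\in\pi^{-1}(y)}\bar P(\bar x,\bar y)$, where $\bar x$ is any point of $\bar V$ with $\pi(\bar x)=x$. Assume that $\bar P$ is uniplicit and that $\mathcal{H}(\bar P)\neq\emptyset$. Then $P$ is uniplicit and $\mathcal{H}(P)\neq\emptyset$.
   Context: A Markov kernel on a finite set $V$ is a $V\times V$ matrix with non-negative entries and row sums 1. It is reversible if there is a probability $\mu$, positive at every point, with $\mu(x)P(x,y)=\mu(y)P(y,x)$ for all $x,y$. It is uniplicit if it is reversible and all its eigenvalues have multiplicity 1. For a Markov kernel $P$ on $V$: $\mathcal{K}(P)$ is the set of Markov kernels $K$ on $V$ with $KP=PK$; $\mathcal{K}(P,x)=\{K(x,\cdot):K\in\mathcal{K}(P)\}$; $\mathcal{H}(P)=\{x\in V:\mathcal{K}(P,x)=\mathcal{P}(V)\}$, with $\mathcal{P}(V)$ the set of probability measures on $V$. $\mathcal{S}_{P}$ is the group of bijections $g:V\to V$ with $P(g(x),g(y))=P(x,y)$ for all $x,y$. The equivalence relation on $\bar V$ induced by $\bar G$ is: $\bar x\equiv\bar y$ iff there is $g\in\bar G$ with $g(\bar x)=\bar y$. The formula for $P$ does not depend on the choice of $\bar x$, because $\bar G\subset\mathcal{S}_{\bar P}$.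 *)

(* Defs.v *)
From mathcomp Require Import all_boot all_order all_algebra all_fingroup.
From mathcomp Require Import mathcomp_extra boolp classical_sets reals.

Set Implicit Arguments.
Unset Strict Implicit.
Unset Printing Implicit Defensive.

Import Order.TTheory GRing.Theory Num.Theory.
Local Open Scope classical_set_scope.
Local Open Scope ring_scope.

Record markovKernel (R : realType) (V : finType) := MarkovKernel {
  kernel_fun :> V -> V -> R;
  kernel_ge0 : forall x y, 0 <= kernel_fun x y;
  kernel_sum1 : forall x, \sum_y kernel_fun x y = 1 }.

Definition probabilities (R : realType) (V : finType) : set (V -> R) :=
  [set mu | (forall x, 0 <= mu x) /\ \sum_x mu x = 1].
Arguments probabilities : clear implicits.

Section Kernels.
Variables (R : realType) (V : finType).
Implicit Types P K : markovKernel R V.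

(* Library matrices are indexed by ordinals, whence the reindexing along the
   enumeration of V. *)
Definition kernel_mx P : 'M[R]_#|V| :=
  \matrix_(i, j) P (enum_val i) (enum_val j).

Definition reversible P : Prop :=
  exists2 mu : V -> R, probabilities R V mu
    & (forall x, 0 < mu x) /\ (forall x y, mu x * P x y = mu y * P y x).

(* The multiplicity is the algebraic one. Looking only at eigenvalues in R
   loses nothing: a reversible kernel is diagonalizable over the reals. *)
Definition uniplicit P : Prop :=
  reversible P /\
  forall a : R, eigenvalue (kernel_mx P) a ->
    mup a (char_poly (kernel_mx P)) = 1%N.

Definition commuting_kernels P : set (markovKernel R V) :=
  [set K | kernel_mx K *m kernel_mx P = kernel_mx P *m kernel_mx K].

Definition commuting_rows P (x : V) : set (V -> R) :=
  [set K x | K in commuting_kernels P].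

Definition hypergroup_points P : set V :=
  [set x | commuting_rows P x = probabilities R V].

Definition kernel_sym P : {set {perm V}} :=
  finset (fun g : {perm V} => [forall x, forall y, P (g x) (g y) == P x y]).

Lemma kernel_symP P (g : {perm V}) :
  reflect (forall x y, P (g x) (g y) = P x y) (g \in kernel_sym P).
Proof.
rewrite inE; apply: (iffP forallP) => [h x y|h x].
  by apply/eqP; move/forallP: (h x); apply.
by apply/forallP => y; apply/eqP.
Qed.

Lemma kernel_sym_group_set P : group_set (kernel_sym P).
Proof.
apply/group_setP; split=> [|g h /kernel_symP Hg /kernel_symP Hh].
  by apply/kernel_symP => x y; rewrite !perm1.
by apply/kernel_symP => x y; rewrite !permM Hh Hg.
Qed.

Canonical kernel_sym_group P := Group (kernel_sym_group_set P).

End Kernels.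

Section Quotient.
Variables (R : realType) (V : finType) (G : {group {perm V}}).

Definition orbit_space : Type :=
  {A : {set V} | A \in orbit 'P G @: [set: V]%SET}.

Definition orbit_proj (x : V) : orbit_space :=
  exist _ (orbit 'P G x) (imset_f _ (finset.in_setT x)).

Lemma orbit_projP x y :
  orbit_proj x = orbit_proj y <-> exists2 g : {perm V}, g \in G & g x = y.
Proof.
split=> [/(congr1 val) /= /orbit_eqP/orbitP[g Gg gy]|[g Gg <-]].
  by exists g^-1%g; rewrite ?groupV // -gy /= /aperm permK.
apply: val_inj => /=; apply/orbit_eqP; rewrite orbit_sym.
exact: (mem_orbit 'P).
Qed.

Lemma orbit_proj_surj (a : orbit_space) : exists x, orbit_proj x == a.
Proof.
by case: a => A HA; case/imsetP: (HA) => x _ e; exists x; apply/eqP/val_inj.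
Qed.

Definition orbit_repr (a : orbit_space) : V := xchoose (orbit_proj_surj a).

Lemma orbit_reprK : cancel orbit_repr orbit_proj.
Proof. by move=> a; apply/eqP/(xchooseP (orbit_proj_surj a)). Qed.

Variable P : markovKernel R V.

Definition quotient_fun (a b : orbit_space) : R :=
  \sum_(y | orbit_proj y == b) P (orbit_repr a) y.

Lemma quotient_fun_ge0 a b : 0 <= quotient_fun a b.
Proof. by apply: sumr_ge0 => y _; apply: kernel_ge0. Qed.

Lemma quotient_fun_sum1 a : \sum_b quotient_fun a b = 1.
Proof.
by rewrite -[RHS](kernel_sum1 P (orbit_repr a)) (partition_big orbit_proj predT).
Qed.

Definition quotient_kernel : markovKernel R orbit_space :=
  MarkovKernel quotient_fun_ge0 quotient_fun_sum1.

(* The choice of orbit representatives is immaterial. *)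
Lemma quotient_kernelE (x : V) (b : orbit_space) :
  G \subset kernel_sym P ->
  quotient_kernel (orbit_proj x) b = \sum_(y | orbit_proj y == b) P x y.
Proof.
move=> sGP; rewrite /= /quotient_fun.
have /orbit_projP[g Gg <-] : orbit_proj x = orbit_proj (orbit_repr (orbit_proj x)).
  by rewrite orbit_reprK.
rewrite (reindex_inj (@perm_inj _ g)) /=; apply: eq_big => y.
  by congr (_ == _); apply/esym/orbit_projP; exists g.
by move/kernel_symP: (fintype.subsetP sGP g Gg) => ->.
Qed.

End Quotient.

(* Main.v *)
(** Let L be the 0-1 matrix of the projection onto the orbits. Then
    Pbar L = L P and L has a left inverse, so char_poly P divides
    char_poly Pbar and the eigenvalues of P stay simple. A uniplicit kernel is
    diagonalizable with distinct eigenvalues, so the matrices commuting with it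
    commute with each other; hence every kernel Kbar commuting with Pbar
    commutes with Gbar and descends to a kernel commuting with P. If x lies in
    H(Pbar), lifting a probability on V to Vbar and descending the kernel Kbar
    that realizes the lift at x shows that the orbit of x lies in H(P). *)
Require Import Defs.
From mathcomp Require Import all_boot all_order all_algebra all_fingroup.
From mathcomp Require Import spectral complex.
From mathcomp Require Import mathcomp_extra boolp classical_sets reals.

Set Implicit Arguments.
Unset Strict Implicit.
Unset Printing Implicit Defensive.

Import Order.TTheory GRing.Theory Num.Theory.
Local Open Scope classical_set_scope.
Local Open Scope ring_scope.

(** * Characteristic polynomials of intertwined matrices *)

Lemma char_poly_intertwine (F : fieldType) n (P A B : 'M[F]_n) :
  P \in unitmx -> P *m A = B *m P -> char_poly A = char_poly B.
Proof.
move=> Pu PA; have Pu' : map_mx polyC P \in unitmx.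
  by rewrite unitmxE det_map_mx rmorph_unit// -unitmxE.
have : map_mx polyC P *m char_poly_mx A = char_poly_mx B *m map_mx polyC P.
  by rewrite mulmxBr mulmxBl -!map_mxM PA scalar_mxC.
move=> /(congr1 determinant); rewrite !det_mulmx mulrC.
by apply: mulIr; rewrite -unitmxE.
Qed.

Lemma char_poly_ublock (R : comNzRingType) m n
    (A : 'M[R]_m) (B : 'M[R]_(m, n)) (D : 'M[R]_n) :
  char_poly (block_mx A B 0 D) = char_poly A * char_poly D.
Proof.
rewrite /char_poly/char_poly_mx map_block_mx/= map_mx0 scalar_mx_block.
by rewrite opp_block_mx add_block_mx oppr0 !addr0 det_ublock.
Qed.

(** The column space of [L] is stable under [A], which acts on it as [B]. In bases where [L] becomes
    [pid_mx n], the matrix of [A] is block upper triangular with a conjugate of [B] as its upper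
    left block. *)
Lemma char_poly_dvd_intertwine (F : fieldType) m n
    (A : 'M[F]_m) (B : 'M[F]_n) (L : 'M[F]_(m, n)) (E : 'M[F]_(n, m)) :
  E *m L = 1%:M -> A *m L = L *m B -> char_poly B %| char_poly A.
Proof.
move=> EL AL; have rL : \rank L = n.
  apply/eqP; rewrite eqn_leq rank_leq_col/= -[X in (X <= _)%N](mxrank1 F n) -EL.
  exact: mxrankM_maxr.
(* Full column rank gives [n <= m]; writing [m] as a sum allows [A] to be cut into blocks. *)
have [k mE] : exists k, m = (n + k)%N.
  by exists (m - n)%N; rewrite subnKC// -rL rank_leq_row.
subst m.
pose C := col_ebase L; pose R := row_ebase L.
have Cu : C \in unitmx by exact: col_ebase_unit.
have Ru : R \in unitmx by exact: row_ebase_unit.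
have LE : L = C *m pid_mx n *m R by rewrite -[LHS]mulmx_ebase rL.
pose A' := invmx C *m A *m C; pose B' := R *m B *m invmx R.
have -> : char_poly A = char_poly A'.
  by apply: (@char_poly_intertwine _ _ (invmx C)); rewrite ?unitmx_inv// mulmxK.
have -> : char_poly B = char_poly B'.
  by apply: (@char_poly_intertwine _ _ R) => //; rewrite mulmxKV.
have : A' *m (pid_mx n : 'M_(n + k, n)) = pid_mx n *m B'.
  have CpE : C *m pid_mx n = L *m invmx R by rewrite LE mulmxK.
  rewrite -!mulmxA CpE !mulmxA -(mulmxA _ A) AL LE.
  by rewrite !mulmxA mulVmx// mul1mx.
rewrite -[A']submxK pid_mx_col mul_block_col !mul_col_mx.
rewrite !mulmx1 !mulmx0 !addr0 mul1mx mul0mx => /eq_col_mx[-> ->].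
by rewrite char_poly_ublock dvdp_mulr.
Qed.

(** * Diagonalization of symmetric and symmetrizable matrices *)

Local Notation toC := (real_complex _).

(** The spectral theorem for normal matrices is applied over [R[i]]. The image of [S] there is
    Hermitian, so its spectrum is real and descends to [r] over [R]; only the change of basis stays
    complex. *)
Lemma symmetric_diagonalization (R : rcfType) n (S : 'M[R]_n) :
  (forall i j, S i j = S j i) ->
  exists P : 'M[R[i]]_n, exists2 r : 'rV[R]_n, P \in unitmx
    & P *m map_mx toC S = map_mx toC (diag_mx r) *m P.
Proof.
move=> Ssym; pose T := map_mx toC S.
have Tsym : T \is symmetricmx.
  apply/is_hermitianmxP; rewrite scale1r map_mx_id//.
  by apply/matrixP => i j; rewrite !mxE Ssym.
have Treal : T \is a mxOver Num.real.
  by apply/mxOverP => i j; rewrite mxE; apply/complex_realP; exists (S i j).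
have /mxOverP spreal := hermitian_spectral_diag_real (realsym_hermsym Tsym Treal).
have /orthomx_spectralP TE := symmetric_normalmx Tsym Treal.
have Pu := spectral_unit T.
move: (spectralmx T) (spectral_diag T) spreal TE Pu => P sp spreal TE Pu.
have spE : sp = map_mx toC (map_mx (@complex.Re R) sp).
  by apply/matrixP => i j; rewrite !mxE RRe_real.
exists P, (map_mx (@complex.Re R) sp) => //.
by rewrite map_diag_mx -spE -/T TE -mulmxA mulKVmx.
Qed.

Lemma symmetrizable_diagonalization (R : rcfType) n
    (A : 'M[R]_n) (d : 'I_n -> R) :
  (forall i, 0 < d i) -> (forall i j, d i * A i j = d j * A j i) ->
  exists P : 'M[R[i]]_n, exists2 r : 'rV[R]_n, P \in unitmx
    & P *m map_mx toC A = map_mx toC (diag_mx r) *m P.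
Proof.
move=> d0 dA.
have s0 i : Num.sqrt (d i) != 0 by rewrite gt_eqF// sqrtr_gt0.
pose D := diag_mx (\row_i Num.sqrt (d i)).
have Du : D \in unitmx.
  by rewrite unitmxE det_diag unitfE; apply/prodf_neq0 => i _; rewrite mxE.
(* Conjugation by the square roots of the weights turns detailed balance into symmetry. *)
pose S := \matrix_(i, j) (Num.sqrt (d i) * A i j / Num.sqrt (d j)).
have DA : D *m A = S *m D.
  apply/matrixP => i j; rewrite mul_diag_mx mul_mx_diag !mxE.
  by rewrite divfK.
have [i j|P [r Pu PS]] := @symmetric_diagonalization _ _ S.
  rewrite !mxE; apply/eqP; rewrite eqr_div// mulrAC [in eqbRHS]mulrAC.
  by rewrite -!expr2 !sqr_sqrtr ?ltW// dA.
exists (P *m map_mx toC D), r; first by rewrite unitmx_mul Pu/= map_unitmx.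
by rewrite -mulmxA -map_mxM DA map_mxM !mulmxA PS.
Qed.

Lemma char_poly_real_diagonalization (R : rcfType) n
    (A : 'M[R]_n) (r : 'rV[R]_n) (P : 'M[R[i]]_n) : P \in unitmx ->
  P *m map_mx toC A = map_mx toC (diag_mx r) *m P ->
  char_poly A = \prod_i ('X - (r 0 i)%:P).
Proof.
move=> Pu /(char_poly_intertwine Pu); rewrite -!map_char_poly.
move=> /map_poly_inj ->; rewrite char_poly_trig ?diag_mx_is_trig//.
by apply: eq_bigr => i _; rewrite mxE eqxx mulr1n.
Qed.

(** * Simple spectrum and commutants *)

Lemma uniq_roots_prod (F : fieldType) n (r : 'I_n -> F) :
  (forall a, root (\prod_i ('X - (r i)%:P)) a ->
    mup a (\prod_i ('X - (r i)%:P)) = 1%N) ->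
  injective r.
Proof.
move=> simple i j rij; apply/eqP/negPn/negP => ij.
have := simple (r i); have p0 : \prod_i ('X - (r i)%:P) != 0.
  by apply/prodf_neq0 => k _; rewrite polyXsubC_eq0.
have : (1 < mup (r i) (\prod_i ('X - (r i)%:P)))%N.
  rewrite mup_geq// (bigD1 i)//= (bigD1 j) 1?eq_sym//= mulrA -rij -expr2.
  exact: dvdp_mulr.
move=> m2 s; move: m2; rewrite s// /root horner_prod (bigD1 i)//=.
by rewrite hornerXsubC subrr mul0r.
Qed.

(** Entry [(i, j)] of the commutation relation says that [B i j] times the difference of the two
    diagonal entries is zero. *)
Lemma comm_diag_mx_inj (F : fieldType) n (d : 'rV[F]_n) (B : 'M[F]_n) :
  injective (d 0) -> B *m diag_mx d = diag_mx d *m B -> is_diag_mx B.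
Proof.
move=> dinj /matrixP Bd; apply/is_diag_mxP => i j ij.
have /eqP := Bd i j; rewrite mul_diag_mx mul_mx_diag !mxE mulrC -subr_eq0.
rewrite -mulrBl mulf_eq0 subr_eq0 => /orP[/eqP/dinj ji|/eqP//].
by rewrite ji eqxx in ij.
Qed.

(** In an eigenbasis of [A], both [B] and [C] become diagonal because the eigenvalues are distinct.
    Diagonal matrices commute, and the equality is pulled back along the injective embedding into
    [R[i]]. *)
Lemma simple_symmetrizable_commutant (R : rcfType) n
    (A B C : 'M[R]_n) (d : 'I_n -> R) :
  (forall i, 0 < d i) -> (forall i j, d i * A i j = d j * A j i) ->
  (forall a, eigenvalue A a -> mup a (char_poly A) = 1%N) ->
  B *m A = A *m B -> C *m A = A *m C -> B *m C = C *m B.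
Proof.
move=> d0 dA simple BA CA.
have [P [r Pu PA]] := symmetrizable_diagonalization d0 dA.
have rinj : injective (r 0).
  apply: uniq_roots_prod; rewrite -(char_poly_real_diagonalization Pu PA) => a.
  by rewrite -eigenvalue_root_char; apply: simple.
pose conj (M : 'M[R]_n) := P *m map_mx toC M *m invmx P.
have conjM M N : conj (M *m N) = conj M *m conj N.
  by rewrite /conj map_mxM !mulmxA mulmxKV.
have conjA : conj A = diag_mx (map_mx toC r).
  by rewrite /conj PA mulmxK ?map_diag_mx.
have conj_diag M : M *m A = A *m M -> is_diag_mx (conj M).
  move=> /(congr1 conj); rewrite !conjM conjA; apply: comm_diag_mx_inj.
  by move=> i j; rewrite !mxE => /complexI/rinj.
have : conj (B *m C) = conj (C *m B).
  have /diag_mxP[b bE] := conj_diag _ BA; have /diag_mxP[c cE] := conj_diag _ CA.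
  by rewrite !conjM bE cE diag_mxC.
move=> /(congr1 (mulmx^~ P)); rewrite /conj !mulmxKV//.
by move=> /(congr1 (mulmx (invmx P))); rewrite !mulKmx// => /map_mx_inj; apply.
Qed.

Lemma mup_dvdp_eq1 (F : fieldType) (p q : {poly F}) a :
  q != 0 -> p %| q -> root p a -> mup a q = 1%N -> mup a p = 1%N.
Proof.
move=> q0 pq pa q1; have p0 := dvdpN0 pq q0; apply/eqP; rewrite eqn_leq.
rewrite -[X in (_ <= X)%N && _]q1 -XsubC_dvd// dvdp_XsubCl pa andbT.
by rewrite mup_geq// (dvdp_trans _ pq)// -mup_geq.
Qed.

(** * Matrices indexed by finite types *)

Definition fun_mx (R : pzRingType) (V W : finType) (f : V -> W -> R) :
  'M[R]_(#|V|, #|W|) := \matrix_(i, j) f (enum_val i) (enum_val j).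

Lemma mul_fun_mx (R : pzRingType) (U V W : finType)
    (f : U -> V -> R) (g : V -> W -> R) :
  fun_mx f *m fun_mx g = fun_mx (fun x y => \sum_z f x z * g z y).
Proof.
apply/matrixP => i j; rewrite !mxE [RHS](reindex (@enum_val V predT))/=.
  by apply: eq_bigr => k _; rewrite !mxE.
by exists enum_rank => x _; rewrite ?enum_valK ?enum_rankK.
Qed.

Lemma fun_mxP (R : pzRingType) (V W : finType) (f g : V -> W -> R) :
  fun_mx f = fun_mx g <-> f =2 g.
Proof.
split=> [/matrixP fg x y|fg]; last by apply/matrixP => i j; rewrite !mxE fg.
by have := fg (enum_rank x) (enum_rank y); rewrite !mxE !enum_rankK.
Qed.

Lemma kernel_mxE (R : realType) (V : finType) (P : markovKernel R V) :
  kernel_mx P = fun_mx P.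
Proof. by []. Qed.

(** Invariance under [g] is recast as commutation with its permutation matrix, so that the commutant
    lemma can be applied to symmetries. *)
Lemma kernel_symE (R : realType) (V : finType) (P : markovKernel R V)
    (g : {perm V}) (M := fun_mx (fun x y => (g x == y)%:R : R)) :
  g \in kernel_sym P <-> M *m kernel_mx P = kernel_mx P *m M.
Proof.
rewrite kernel_mxE !mul_fun_mx fun_mxP.
have L x y : \sum_z (g x == z)%:R * P z y = P (g x) y.
  rewrite (bigD1 (g x))//= eqxx mul1r big1 ?addr0// => z.
  by rewrite eq_sym => /negbTE ->; rewrite mul0r.
have Rr x y : \sum_z P x z * (g z == g y)%:R = P x y.
  rewrite (bigD1 y)//= eqxx mulr1 big1 ?addr0// => z.
  by rewrite (inj_eq perm_inj) => /negbTE ->; rewrite mulr0.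
split=> [/kernel_symP gP x y|H]; last first.
  by apply/kernel_symP => x y; rewrite -[RHS]Rr -H L.
by rewrite L -(permKV g y) Rr gP.
Qed.

Lemma sum_fiber (R : pzSemiRingType) (V W : finType) (p : V -> W) (f : V -> R)
    (b : W) :
  \sum_y f y * (p y == b)%:R = \sum_(y | p y == b) f y.
Proof.
rewrite [RHS]big_mkcond; apply: eq_bigr => y _.
by case: eqP; rewrite ?mulr1 ?mulr0.
Qed.

(** * Descent to the orbit space *)

Section Quotient.
Variables (R : realType) (V : finType) (G : {group {perm V}}).
Implicit Types P K : markovKernel R V.

Definition orbit_mx : 'M[R]_(#|V|, #|(orbit_space G : finType)|) :=
  fun_mx (fun x b => (orbit_proj G x == b)%:R).

Definition orbit_repr_mx : 'M[R]_(#|(orbit_space G : finType)|, #|V|) :=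
  fun_mx (fun a y => (orbit_repr a == y)%:R).

Lemma orbit_mx_intertwine P : G \subset kernel_sym P ->
  kernel_mx P *m orbit_mx = orbit_mx *m kernel_mx (quotient_kernel G P).
Proof.
move=> GP; rewrite !kernel_mxE !mul_fun_mx; apply/fun_mxP => x b.
rewrite sum_fiber -quotient_kernelE// [RHS](bigD1 (orbit_proj G x))//= eqxx mul1r.
by rewrite big1 ?addr0// => c; rewrite eq_sym => /negbTE ->; rewrite mul0r.
Qed.

Lemma orbit_mx_left_inverse :
  orbit_repr_mx *m orbit_mx = 1%:M.
Proof.
rewrite mul_fun_mx; apply/matrixP => i j; rewrite !mxE sum_fiber.
rewrite -(inj_eq enum_val_inj) -[enum_val i in RHS]orbit_reprK.
set x := orbit_repr _.
rewrite -sum_fiber (bigD1 x)//= eqxx mul1r big1 ?addr0// => z.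
by rewrite eq_sym => /negbTE ->; rewrite mul0r.
Qed.

Lemma quotient_reversible P : G \subset kernel_sym P ->
  reversible P -> reversible (quotient_kernel G P).
Proof.
move=> GP [mu [mu0 mu1] [mupos muP]].
(* The reversing measure of the quotient is the image of [mu] under the projection. *)
exists (fun a => \sum_(x | orbit_proj G x == a) mu x).
  split=> [a|]; first by apply: sumr_ge0.
  by rewrite -[RHS]mu1 [RHS](partition_big (orbit_proj G) predT).
split=> [a|a b].
  rewrite (bigD1 (orbit_repr a)) ?orbit_reprK//= ltr_pwDl//.
  exact: sumr_ge0.
(* The flow between two orbits is the total flow between their points, which is symmetric by
   detailed balance for [P]. *)
have E c e : (\sum_(x | orbit_proj G x == c) mu x) * quotient_kernel G P c e =
    \sum_(x | orbit_proj G x == c) \sum_(y | orbit_proj G y == e) mu x * P x y.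
  rewrite mulr_suml; apply: eq_bigr => x /eqP <-.
  by rewrite quotient_kernelE// mulr_sumr.
rewrite !E exchange_big/=; apply: eq_bigr => x _; apply: eq_bigr => y _.
exact: muP.
Qed.

(** Products of kernels also pass through [orbit_mx], which can then be cancelled by its left
    inverse. *)
Lemma quotient_commuting P K :
  G \subset kernel_sym P -> G \subset kernel_sym K ->
  commuting_kernels P K ->
  commuting_kernels (quotient_kernel G P) (quotient_kernel G K).
Proof.
move=> GP GK /= KP.
have L X Y : G \subset kernel_sym X -> G \subset kernel_sym Y ->
    kernel_mx X *m kernel_mx Y *m orbit_mx =
    orbit_mx *m (kernel_mx (quotient_kernel G X) *m
                 kernel_mx (quotient_kernel G Y)).
  move=> GX GY; rewrite -mulmxA orbit_mx_intertwine//.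
  by rewrite mulmxA orbit_mx_intertwine// mulmxA.
have : orbit_mx *m (kernel_mx (quotient_kernel G K) *m
                    kernel_mx (quotient_kernel G P)) =
       orbit_mx *m (kernel_mx (quotient_kernel G P) *m
                    kernel_mx (quotient_kernel G K)).
  by rewrite -!L// KP.
move=> /(congr1 (mulmx orbit_repr_mx)).
by rewrite !(mulmxA _ orbit_mx) orbit_mx_left_inverse !mul1mx.
Qed.

Lemma quotient_uniplicit P : G \subset kernel_sym P ->
  uniplicit P -> uniplicit (quotient_kernel G P).
Proof.
move=> GP [revP simple]; split; first exact: quotient_reversible.
move=> a; rewrite eigenvalue_root_char => Qa.
have dv := char_poly_dvd_intertwine orbit_mx_left_inverse (orbit_mx_intertwine GP).
apply: (mup_dvdp_eq1 _ dv Qa); first exact/monic_neq0/char_poly_monic.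
apply: simple; rewrite eigenvalue_root_char -dvdp_XsubCl.
by rewrite (dvdp_trans _ dv) ?dvdp_XsubCl.
Qed.

(** The permutation matrix of each [g] in [G] and the matrix of [K] both lie in the commutant of
    [P], which is commutative; the reversing measure supplies the symmetrizing weights. *)
Lemma sub_kernel_sym_commuting P K : G \subset kernel_sym P ->
  uniplicit P -> commuting_kernels P K -> G \subset kernel_sym K.
Proof.
move=> GP [[mu _ [mupos muP]] simple] /= KP; apply/fintype.subsetP => g Gg.
apply/kernel_symE; have /kernel_symE gP := fintype.subsetP GP g Gg.
apply: (simple_symmetrizable_commutant (d := mu \o enum_val) _ _ simple gP KP).
  by move=> i; apply: mupos.
by move=> i j; rewrite !mxE; apply: muP.
Qed.

Lemma quotient_hypergroup_point P (x : V) : G \subset kernel_sym P ->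
  uniplicit P -> hypergroup_points P x ->
  hypergroup_points (quotient_kernel G P) (orbit_proj G x).
Proof.
move=> GP uP /= Hx; apply/seteqP; split=> [_ [K _ <-]|mu [mu0 mu1]].
  by split=> [y|]; [exact: kernel_ge0 | exact: kernel_sum1].
(* This lift of [mu] puts the mass of each orbit on its chosen representative; only its orbit sums
   matter below. *)
pose nu y := mu (orbit_proj G y) * (orbit_repr (orbit_proj G y) == y)%:R.
have nuE b : \sum_(y | orbit_proj G y == b) nu y = mu b.
  rewrite (bigD1 (orbit_repr b)) ?orbit_reprK//= /nu orbit_reprK eqxx mulr1.
  rewrite big1 ?addr0// => y /andP[/eqP ->].
  by rewrite eq_sym => /negbTE ->; rewrite mulr0.
have : probabilities R V nu.
  split=> [y|]; first by rewrite mulr_ge0.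
  by rewrite (partition_big (orbit_proj G) predT)//= -[RHS]mu1; apply: eq_bigr.
rewrite -Hx => -[K KP Kx]; have GK := sub_kernel_sym_commuting GP uP KP.
exists (quotient_kernel G K); first exact: quotient_commuting.
(* As [K] is [G]-invariant, the quotient row at the orbit of [x] can be computed at [x] itself,
   where [K] has row [nu]. *)
by apply/funext => b; rewrite quotient_kernelE// Kx nuE.
Qed.

End Quotient.

Theorem proposition7 (R : realType) (Vbar : finType)
    (Pbar : markovKernel R Vbar) (Gbar : {group {perm Vbar}})
    (GbarS : Gbar \subset kernel_sym Pbar)
    (Pbar_uniplicit : uniplicit Pbar)
    (Pbar_hyper : hypergroup_points Pbar !=set0) :
  uniplicit (quotient_kernel Gbar Pbar) /\
  hypergroup_points (quotient_kernel Gbar Pbar) !=set0.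
Proof.
split; first exact: quotient_uniplicit.
have [x Hx] := Pbar_hyper.
by exists (orbit_proj Gbar x); apply: quotient_hypergroup_point.
Qed.
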